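(* For each $\boldsymbol i\in I_e^n$ there is an expansion in the generalized blob algebra $B_n$ of the form $$e(\boldsymbol i)=\sum_{\mu}D_\mu,$$ where the sum runs over one-column $l$-multipartitions $\mu$ of $n$ and each $D_\mu$ belongs to the two-sided ideal of $B_n$ generated by $e(\boldsymbol i^\mu)$.
   Context: **Combinatorics.** A one-column $l$-multipartition of $n$ is a tuple $\lambda=((1^{a_1}),\dots,(1^{a_l}))$ with integers $a_m\ge 0$, $\sum_m a_m=n$; its diagram is $[\lambda]=\{(r,1,m):1\le m\le l,\ 1\le r\le a_m\}$. Nodes are totally ordered by: $(r,1,m)\lhd(r',1,m')$ iff $r>r'$, or $r=r'$ and $m>m'$. $\mathfrak t^\lambda:\{1,\dots,n\}\to[\lambda]$ is the bijection with $\mathfrak t^\lambda(1)\rhd\cdots\rhd\mathfrak t^\lambda(n)$ (numbers filled in along rows). **Algebra.** Fix integers $e,l,n>1$, a field $F$ and a primitive $e$-th root of unity $q\in F\setminus\{1\}$; $I_e=\mathbb Z/e\mathbb Z$; $S_n$ acts on $I_e^n$ by permuting coordinates, $s_r=(r,r+1)$. Fix $\hat\kappa\in\mathbb Z^l$; $\kappa_m\in I_e$ is the image of $\hat\kappa_m$, also identified with its representative in $\{0,\dots,e-1\}$. $\hat\kappa$ is strongly adjacency-free: (i) $\hat\kappa_{m+1}-\hat\kappa_m\ge n$; (ii) $\kappa_i-\kappa_j\not\equiv 0,\pm1\bmod e$ for $i\ne j$; (iii) $\kappa_1\not\equiv\kappa_l+2\bmod e$; (iv) $\kappa_1<\dots<\kappa_l$.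 The generalized blob algebra $B_n$ is the unital associative $F$-algebra with generators $\psi_1,\dots,\psi_{n-1},y_1,\dots,y_n,e(\boldsymbol i)$ ($\boldsymbol i\in I_e^n$) and relations: $e(\boldsymbol i)e(\boldsymbol j)=\delta_{\boldsymbol i\boldsymbol j}e(\boldsymbol i)$; $\sum_{\boldsymbol i}e(\boldsymbol i)=1$; $e(\boldsymbol i)=0$ if $i_1\notin\{\kappa_1,\dots,\kappa_l\}$; $e(\boldsymbol i)=0$ if $i_1\in\{\kappa_1,\dots,\kappa_l\}$ and $i_2=i_1+1$; $y_1e(\boldsymbol i)=0$ if $i_1\in\{\kappa_1,\dots,\kappa_l\}$; $y_re(\boldsymbol i)=e(\boldsymbol i)y_r$; $\psi_re(\boldsymbol i)=e(s_r\cdot\boldsymbol i)\psi_r$; $y_ry_s=y_sy_r$; $\psi_ry_s=y_s\psi_r$ if $s\ne r,r+1$; $\psi_r\psi_s=\psi_s\psi_r$ if $|r-s|>1$; $\psi_ry_{r+1}e(\boldsymbol i)=(y_r\psi_r-\delta_{i_r,i_{r+1}})e(\boldsymbol i)$; $y_{r+1}\psi_re(\boldsymbol i)=(\psi_ry_r-\delta_{i_r,i_{r+1}})e(\boldsymbol i)$; $\psi_r^2e(\boldsymbol i)$ equals $0$ if $i_r=i_{r+1}$, $e(\boldsymbol i)$ if $i_r\ne i_{r+1},i_{r+1}\pm1$, $(y_{r+1}-y_r)e(\boldsymbol i)$ if $i_{r+1}=i_r+1$, $(y_r-y_{r+1})e(\boldsymbol i)$ if $i_{r+1}=i_r-1$;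 $\psi_r\psi_{r+1}\psi_re(\boldsymbol i)=(\psi_{r+1}\psi_r\psi_{r+1}+\alpha)e(\boldsymbol i)$ with $\alpha=-1$ if $i_{r+2}=i_r=i_{r+1}-1$, $\alpha=1$ if $i_{r+2}=i_r=i_{r+1}+1$, $\alpha=0$ otherwise. The residue of a node $(r,1,m)$ is $\mathrm{res}=\kappa_m+1-r\in I_e$, and $\boldsymbol i^\mu=(\mathrm{res}(\mathfrak t^\mu(1)),\dots,\mathrm{res}(\mathfrak t^\mu(n)))\in I_e^n$. *)

(* Defs.v *)
From HB Require Import structures.
From mathcomp Require Import all_boot all_order perm all_algebra.
From mathcomp Require Import finmap monalg.
From mathcomp Require Import boolp classical_sets.

Set Implicit Arguments.
Unset Strict Implicit.
Unset Printing Implicit Defensive.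

Import Order.TTheory GRing.Theory Num.Theory.

Local Open Scope ring_scope.
Local Open Scope quotient_scope.

Record two_sided_ideal (A : pzRingType) (I : set A) : Prop := TwoSidedIdeal {
  ideal0 : I 0;
  idealD : forall x y, I x -> I y -> I (x + y);
  idealMl : forall a x, I x -> I (a * x);
  idealMr : forall x a, I x -> I (x * a) }.

Definition ideal_span (A : pzRingType) (S : set A) : set A :=
  smallest (@two_sided_ideal A) S.

Section IdealTheory.
Variables (A : pzRingType) (S : set A).

Lemma ideal_span_ideal : two_sided_ideal (ideal_span S).
Proof.
split=> [I [hI _]|x y hx hy I hI|a x hx I hI|x a hx I hI].
- exact: ideal0.
- by apply: idealD (hx I hI) (hy I hI); case: hI.
- by apply: idealMl (hx I hI); case: hI.
- by apply: idealMr (hx I hI); case: hI.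
Qed.

Lemma ideal_spanN x : ideal_span S x -> ideal_span S (- x).
Proof. by rewrite -mulN1r; apply: idealMl; exact: ideal_span_ideal. Qed.

Definition ideal_eqv (x y : A) : bool := `[< ideal_span S (x - y) >].

Lemma ideal_eqvP x y : reflect (ideal_span S (x - y)) (ideal_eqv x y).
Proof. exact: asboolP. Qed.

Lemma ideal_eqv_is_equiv : equiv_class_of ideal_eqv.
Proof.
split=> [x|x y|y x z].
- by apply/ideal_eqvP; rewrite subrr; exact: ideal0 ideal_span_ideal.
- by apply/ideal_eqvP/ideal_eqvP => /ideal_spanN; rewrite opprB.
- move=> /ideal_eqvP xy /ideal_eqvP yz; apply/ideal_eqvP.
  by rewrite -(subrKA y); exact: idealD ideal_span_ideal _ _ xy yz.
Qed.

Canonical ideal_eqv_equiv := EquivRelPack ideal_eqv_is_equiv.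
Canonical ideal_eqv_encModRel := defaultEncModRel ideal_eqv.

End IdealTheory.

Definition quot_alg (A : pzRingType) (S : set A) := {eq_quot (@ideal_eqv A S)}.

Section QuotRing.
Variables (A : pzRingType) (S : set A).
Local Notation Q := (quot_alg S).

HB.instance Definition _ : EqQuotient A (@ideal_eqv A S) Q := EqQuotient.on Q.
HB.instance Definition _ := Choice.on Q.

Lemma pi_eqP (x y : A) : \pi_Q x = \pi_Q y <-> ideal_span S (x - y).
Proof.
split; first by move/eqP; rewrite piE => /ideal_eqvP.
by move=> /ideal_eqvP h; apply/eqP; rewrite piE.
Qed.

Lemma repr_piB (x : A) : ideal_span S (repr (\pi_Q x) - x).
Proof. by apply/pi_eqP; rewrite reprK. Qed.

Definition quot_zero : Q := \pi_Q 0.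
Definition quot_one : Q := \pi_Q 1.
Definition quot_opp (x : Q) : Q := \pi_Q (- repr x).
Definition quot_add (x y : Q) : Q := \pi_Q (repr x + repr y).
Definition quot_mul (x y : Q) : Q := \pi_Q (repr x * repr y).

Let pi_opp x : quot_opp (\pi_Q x) = \pi_Q (- x).
Proof.
apply/pi_eqP; rewrite opprK addrC -opprB.
by apply: ideal_spanN; exact: repr_piB.
Qed.

Let pi_add x y : quot_add (\pi_Q x) (\pi_Q y) = \pi_Q (x + y).
Proof.
apply/pi_eqP; rewrite opprD addrACA.
exact: idealD (ideal_span_ideal S) _ _ (repr_piB x) (repr_piB y).
Qed.

Let pi_mul x y : quot_mul (\pi_Q x) (\pi_Q y) = \pi_Q (x * y).
Proof.
apply/pi_eqP; set a := repr _; set b := repr _.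
have -> : a * b - x * y = (a - x) * b + x * (b - y).
  by rewrite mulrBl mulrBr addrA subrK.
have hI := ideal_span_ideal S.
apply: (idealD hI); [apply: (idealMr hI)|apply: (idealMl hI)]; exact: repr_piB.
Qed.

Let quotW (P : Q -> Prop) : (forall x, P (\pi_Q x)) -> forall x, P x.
Proof. by move=> h x; rewrite -[x]reprK. Qed.

Fact quot_addA : associative quot_add.
Proof.
by elim/quotW=> x; elim/quotW=> y; elim/quotW=> z; rewrite !pi_add addrA.
Qed.

Fact quot_addC : commutative quot_add.
Proof. by elim/quotW=> x; elim/quotW=> y; rewrite !pi_add addrC. Qed.

Fact quot_add0 : left_id quot_zero quot_add.
Proof. by elim/quotW=> x; rewrite pi_add add0r. Qed.

Fact quot_addN : left_inverse quot_zero quot_opp quot_add.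
Proof. by elim/quotW=> x; rewrite pi_opp pi_add addNr. Qed.

HB.instance Definition _ :=
  GRing.isZmodule.Build Q quot_addA quot_addC quot_add0 quot_addN.

Let pi_addR x y : \pi_Q x + \pi_Q y = \pi_Q (x + y) :> Q.
Proof. exact: pi_add. Qed.

Fact quot_mulA : associative quot_mul.
Proof.
by elim/quotW=> x; elim/quotW=> y; elim/quotW=> z; rewrite !pi_mul mulrA.
Qed.

Fact quot_mul1 : left_id quot_one quot_mul.
Proof. by elim/quotW=> x; rewrite pi_mul mul1r. Qed.

Fact quot_mulr1 : right_id quot_one quot_mul.
Proof. by elim/quotW=> x; rewrite pi_mul mulr1. Qed.

Fact quot_mulDl : left_distributive quot_mul +%R.
Proof.
elim/quotW=> x; elim/quotW=> y; elim/quotW=> z.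
by rewrite pi_addR !pi_mul pi_addR mulrDl.
Qed.

Fact quot_mulDr : right_distributive quot_mul +%R.
Proof.
elim/quotW=> x; elim/quotW=> y; elim/quotW=> z.
by rewrite pi_addR !pi_mul pi_addR mulrDr.
Qed.

HB.instance Definition _ := GRing.Zmodule_isPzRing.Build Q
  quot_mulA quot_mul1 quot_mulr1 quot_mulDl quot_mulDr.

Definition quot_pi (x : A) : Q := \pi_Q x.

Fact quot_pi_is_zmod_morphism : zmod_morphism quot_pi.
Proof.
by move=> x y; rewrite /quot_pi -pi_add -pi_opp; done.
Qed.

Fact quot_pi_is_monoid_morphism : monoid_morphism quot_pi.
Proof. by split=> // x y; rewrite /quot_pi -pi_mul. Qed.

HB.instance Definition _ :=
  GRing.isZmodMorphism.Build A Q quot_pi quot_pi_is_zmod_morphism.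
HB.instance Definition _ :=
  GRing.isMonoidMorphism.Build A Q quot_pi quot_pi_is_monoid_morphism.

Lemma quot_pi_eqP (x y : A) : quot_pi x = quot_pi y <-> ideal_span S (x - y).
Proof. exact: pi_eqP. Qed.

Lemma quot_pi_surj (u : Q) : exists x, u = quot_pi x.
Proof. by exists (repr u); rewrite /quot_pi reprK. Qed.

End QuotRing.

(* MathComp requires 1 != 0 in an [algType]. As quotients may vanish, the
   quotient algebra is given as a [pzRingType] that is also an [lmodType F],
   together with the compatibility lemmas quot_scalerAl and quot_scalerAr. *)
Section QuotAlgebra.
Variables (F : fieldType) (A : algType F) (S : set A).
Local Notation Q := (quot_alg S).
Local Notation pi := (@quot_pi A S).

Definition quot_scale (a : F) (u : Q) : Q := pi (a *: repr u).

Let pi_scale a x : quot_scale a (pi x) = pi (a *: x).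
Proof.
apply/quot_pi_eqP; rewrite -scalerBr -[X in _ *: X]mul1r scalerAl.
by apply: (idealMl (ideal_span_ideal S)); exact: repr_piB.
Qed.

Let quotW (P : Q -> Prop) : (forall x, P (pi x)) -> forall x, P x.
Proof. by move=> h x; have [y ->] := quot_pi_surj x. Qed.

Fact quot_scalerA a b u :
  quot_scale a (quot_scale b u) = quot_scale (a * b) u.
Proof. by elim/quotW: u => x; rewrite !pi_scale scalerA. Qed.

Fact quot_scale1r : left_id 1 quot_scale.
Proof. by elim/quotW=> x; rewrite pi_scale scale1r. Qed.

Fact quot_scalerDr : right_distributive quot_scale +%R.
Proof.
move=> a; elim/quotW=> x; elim/quotW=> y.
by rewrite -rmorphD !pi_scale -rmorphD scalerDr.
Qed.

Fact quot_scalerDl u : {morph quot_scale^~ u : a b / a + b}.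
Proof.
by elim/quotW: u => x a b /=; rewrite !pi_scale -rmorphD scalerDl.
Qed.

HB.instance Definition _ := GRing.Zmodule_isLmodule.Build F Q
  quot_scalerA quot_scale1r quot_scalerDr quot_scalerDl.

Lemma quot_piZ a x : pi (a *: x) = a *: pi x.
Proof. by rewrite -pi_scale. Qed.

Lemma quot_scalerAl (a : F) (u v : Q) : a *: (u * v) = (a *: u) * v.
Proof.
elim/quotW: u => x; elim/quotW: v => y.
by rewrite -rmorphM -!quot_piZ -rmorphM scalerAl.
Qed.

Lemma quot_scalerAr (a : F) (u v : Q) : a *: (u * v) = u * (a *: v).
Proof.
elim/quotW: u => x; elim/quotW: v => y.
by rewrite -rmorphM -!quot_piZ -rmorphM scalerAr.
Qed.

End QuotAlgebra.

(* The free unital associative F-algebra on X, as the algebra of the free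
   monoid. *)
Definition free_alg (F : fieldType) (X : choiceType) := {malg F[{fmonom X}]}.

Section FreeAlgebra.
Variables (F : fieldType) (X : choiceType).

HB.instance Definition _ := GRing.Lalgebra.on (free_alg F X).

Fact free_alg_scalerAr (a : F) (x y : free_alg F X) :
  a *: (x * y) = x * (a *: y).
Proof.
apply/malgP=> m; rewrite mcoeffZ.
have hxx := fsubset_refl (msupp x); have hyy := fsubset_refl (msupp y).
rewrite (mcoeffMlw m hxx hyy) (mcoeffMlw m hxx (msuppZ_le a y)) mulr_sumr.
apply: eq_bigr => k _; rewrite mulr_sumr.
by apply: eq_bigr => k' _; rewrite mcoeffZ mulrnAr mulrCA.
Qed.

HB.instance Definition _ :=
  GRing.Lalgebra_isAlgebra.Build F (free_alg F X) free_alg_scalerAr.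

Definition free_gen (x : X) : free_alg F X := << (fmu x) >>.

End FreeAlgebra.

(* The algebra with generators X and relations u = v for all [rel u v]. *)
Definition presented_alg (F : fieldType) (X : choiceType)
    (rel : free_alg F X -> free_alg F X -> Prop) :=
  quot_alg [set w : free_alg F X | exists u v, rel u v /\ w = u - v]%classic.

Lemma presented_algP (F : fieldType) (X : choiceType)
    (rel : free_alg F X -> free_alg F X -> Prop) u v :
  rel u v -> quot_pi _ u = quot_pi _ v :> presented_alg rel.
Proof.
by move=> uv; apply/quot_pi_eqP; apply: sub_gen_smallest; exists u, v.
Qed.

(* Strand indices are 0-based: [PsiGen r], [YGen r] and i`_r stand for the
   mathematical psi_(r+1), y_(r+1) and i_(r+1). *)
Inductive blob_gen (e n : nat) :=
  | PsiGen of 'I_n.-1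
  | YGen of 'I_n
  | EGen of n.-tuple 'Z_e.

Section BlobGenChoice.
Variables e n : nat.

Definition blob_gen_code (x : blob_gen e n) :
    'I_n.-1 + 'I_n + n.-tuple 'Z_e :=
  match x with
  | PsiGen r => inl (inl r)
  | YGen r => inl (inr r)
  | EGen i => inr i
  end.

Definition blob_gen_decode (x : 'I_n.-1 + 'I_n + n.-tuple 'Z_e) :
    blob_gen e n :=
  match x with
  | inl (inl r) => PsiGen e r
  | inl (inr r) => YGen e r
  | inr i => EGen i
  end.

Fact blob_gen_codeK : cancel blob_gen_code blob_gen_decode.
Proof. by case. Qed.

HB.instance Definition _ :=
  Choice.copy (blob_gen e n) (can_type blob_gen_codeK).

End BlobGenChoice.

Definition strand_lo n (r : 'I_n.-1) : 'I_n := widen_ord (leq_pred n) r.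

Definition strand_hi n (r : 'I_n.-1) : 'I_n :=
  Ordinal (etrans (esym (ltn_predRL r n)) (ltn_ord r)).

Definition swap_strands (e n : nat) (r : 'I_n.-1) (i : n.-tuple 'Z_e) :
    n.-tuple 'Z_e :=
  [tuple tnth i (tperm (strand_lo r) (strand_hi r) j) | j < n].

Section BlobRelations.
Variables (F : fieldType) (e l n : nat) (kappa : 'I_l -> 'Z_e).
Implicit Types (i j : n.-tuple 'Z_e).

Definition free_psi (r : 'I_n.-1) := free_gen F (PsiGen e r).
Definition free_y (r : 'I_n) := free_gen F (YGen e r).
Definition free_e i := free_gen F (EGen i).

Local Notation Psi := free_psi.
Local Notation Y := free_y.
Local Notation E := free_e.
Local Notation lo := strand_lo.
Local Notation hi := strand_hi.

Definition braid_coef (i : n.-tuple 'Z_e) (r : nat) : F :=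
  if (i`_r.+2 == i`_r) && (i`_r == i`_r.+1 - 1) then -1
  else if (i`_r.+2 == i`_r) && (i`_r == i`_r.+1 + 1) then 1
  else 0.

Inductive blob_rel :
    free_alg F (blob_gen e n) -> free_alg F (blob_gen e n) -> Prop :=
  | BlobEE i j :
      blob_rel (E i * E j) (if i == j then E i else 0)
  | BlobE1 :
      blob_rel (\sum_(i : n.-tuple 'Z_e) E i) 1
  | BlobE_start i :
      i`_0 \notin codom kappa ->
      blob_rel (E i) 0
  | BlobE_second i :
      i`_0 \in codom kappa -> i`_1 = i`_0 + 1 ->
      blob_rel (E i) 0
  | BlobYE_start (r : 'I_n) i :
      val r = 0%N -> i`_0 \in codom kappa ->
      blob_rel (Y r * E i) 0
  | BlobYE r i :
      blob_rel (Y r * E i) (E i * Y r)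
  | BlobPsiE (r : 'I_n.-1) i :
      blob_rel (Psi r * E i) (E (swap_strands r i) * Psi r)
  | BlobYY r s :
      blob_rel (Y r * Y s) (Y s * Y r)
  | BlobPsiY r s :
      s != lo r -> s != hi r ->
      blob_rel (Psi r * Y s) (Y s * Psi r)
  | BlobPsiPsi (r s : 'I_n.-1) :
      (r.+1 < s)%N || (s.+1 < r)%N ->
      blob_rel (Psi r * Psi s) (Psi s * Psi r)
  | BlobPsiYhi (r : 'I_n.-1) i :
      blob_rel (Psi r * Y (hi r) * E i)
               ((Y (lo r) * Psi r - (i`_r == i`_r.+1)%:R) * E i)
  | BlobYhiPsi (r : 'I_n.-1) i :
      blob_rel (Y (hi r) * Psi r * E i)
               ((Psi r * Y (lo r) - (i`_r == i`_r.+1)%:R) * E i)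
  | BlobPsi2_eq (r : 'I_n.-1) i :
      i`_r = i`_r.+1 ->
      blob_rel (Psi r ^+ 2 * E i) 0
  | BlobPsi2_far (r : 'I_n.-1) i :
      i`_r \notin [:: i`_r.+1; i`_r.+1 + 1; i`_r.+1 - 1] ->
      blob_rel (Psi r ^+ 2 * E i) (E i)
  | BlobPsi2_up (r : 'I_n.-1) i :
      i`_r.+1 = i`_r + 1 ->
      blob_rel (Psi r ^+ 2 * E i) ((Y (hi r) - Y (lo r)) * E i)
  | BlobPsi2_down (r : 'I_n.-1) i :
      i`_r.+1 = i`_r - 1 ->
      blob_rel (Psi r ^+ 2 * E i) ((Y (lo r) - Y (hi r)) * E i)
  | BlobBraid (r s : 'I_n.-1) i :
      val s = r.+1 ->
      blob_rel (Psi r * Psi s * Psi r * E i)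
               ((Psi s * Psi r * Psi s + (braid_coef i r)%:A) * E i).

Definition gen_blob := presented_alg blob_rel.

HB.instance Definition _ := GRing.PzRing.on gen_blob.
HB.instance Definition _ := GRing.Lmodule.on gen_blob.

Definition blob_psi (r : 'I_n.-1) : gen_blob := quot_pi _ (Psi r).
Definition blob_y (r : 'I_n) : gen_blob := quot_pi _ (Y r).
Definition blob_e (i : n.-tuple 'Z_e) : gen_blob := quot_pi _ (E i).

End BlobRelations.

(* In a one-column multipartition ((1^{a_1}), ..., (1^{a_l})) of n, each a_m is
   at most n, so that these form a finite type. *)
Definition onecol_mpart (l n : nat) :=
  {a : {ffun 'I_l -> 'I_n.+1} | (\sum_(m < l) a m == n)%N}.

(* The node (r, 1, m) is encoded by the pair (r, m), where the row r starts
   at 1 and the component m at 0. *)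
Definition node (l : nat) := (nat * 'I_l)%type.

Definition node_lt l (x y : node l) : bool :=
  (y.1 < x.1)%N || (x.1 == y.1) && (y.2 < x.2)%N.

Section Tableau.
Variables (l n : nat) (mu : onecol_mpart l n).

Definition diagram : seq (node l) :=
  [seq (r, m) | m <- enum 'I_l, r <- iota 1 (val mu m)].

Lemma mem_diagram (x : node l) :
  (x \in diagram) = (0 < x.1 <= val mu x.2)%N.
Proof.
case: x => r m; apply/allpairsPdep/idP => [[m' [r' [_ + [-> ->]]]]|].
  by rewrite mem_iota add1n ltnS.
by move=> h; exists m, r; rewrite mem_enum mem_iota add1n ltnS.
Qed.

Lemma diagram_uniq : uniq diagram.
Proof.
apply: allpairs_uniq_dep; rewrite ?enum_uniq //.
  by move=> m _; exact: iota_uniq.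
by move=> [m r] [m' r'] _ _ [-> ->].
Qed.

Definition node_geq (x y : node l) : bool := (x == y) || node_lt y x.

Fact tableau_subproof : size (sort node_geq diagram) == n.
Proof.
rewrite size_sort size_allpairs_dep sumnE big_map big_enum.
have /eqP mu_n := valP mu; apply/eqP; apply: etrans mu_n.
by apply: eq_bigr => m _; rewrite size_iota.
Qed.

(* t^mu(1), ..., t^mu(n): the nodes of mu in decreasing order. *)
Definition tableau : n.-tuple (node l) := Tuple tableau_subproof.

Lemma tableau_perm : perm_eq tableau diagram.
Proof. by rewrite /= perm_sort. Qed.

Lemma tableau_decreasing : sorted (fun x y => node_lt y x) tableau.
Proof.
have tot : total node_geq.
  move=> [r m] [r' m']; rewrite /node_geq /node_lt /= !xpair_eqE -!val_eqE /=.
  by case: (ltngtP r r'); case: (ltngtP m m').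
have := sort_sorted tot diagram.
have : uniq (sort node_geq diagram) by rewrite sort_uniq diagram_uniq.
rewrite /tableau /=; case: (sort _ _) => //= x s.
elim: s x => //= y s IH x /andP[/norP[xy xs] us] /andP[h hs].
by move: h; rewrite /node_geq (negPf xy) /= => ->; apply: IH us hs.
Qed.

End Tableau.

Definition residue e l (kappa : 'I_l -> 'Z_e) (x : node l) : 'Z_e :=
  kappa x.2 + 1 - x.1%:R.

Definition residue_seq e l n (kappa : 'I_l -> 'Z_e) (mu : onecol_mpart l n) :
    n.-tuple 'Z_e :=
  map_tuple (residue kappa) (tableau mu).

Definition kappa_of e l (khat : 'I_l -> int) (m : 'I_l) : 'Z_e :=
  (khat m)%:~R.

Record strongly_adjacency_free (e l n : nat) (khat : 'I_l -> int) : Prop :=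
  StronglyAdjacencyFree {
    saf_gap : forall m m' : 'I_l, val m' = m.+1 -> n%:Z <= khat m' - khat m;
    saf_nonadjacent : forall i j : 'I_l, i != j ->
      kappa_of e khat i - kappa_of e khat j \notin [:: 0; 1; -1];
    saf_ends : forall m0 m1 : 'I_l, val m0 = 0%N -> val m1 = l.-1 ->
      kappa_of e khat m0 != kappa_of e khat m1 + 2;
    (* compares the representatives in {0, ..., e - 1} *)
    saf_increasing : forall m m' : 'I_l, val m' = m.+1 ->
      (val (kappa_of e khat m) < val (kappa_of e khat m'))%N }.

(* Main.v *)
Require Import Defs.
From HB Require Import structures.
From mathcomp Require Import all_boot all_order all_algebra.
From mathcomp Require Import perm classical_sets zify ring.

Set Implicit Arguments.
Unset Strict Implicit.
Unset Printing Implicit Defensive.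

Import Order.TTheory GRing.Theory Num.Theory.
Local Open Scope ring_scope.

(** Let K be the set of sums of elements D_mu of the ideals generated by the
    e(i^mu).  It is a two-sided ideal containing every e(i^mu), and the claim is
    that it contains e(i) for every word i.

    For a shape lambda (a list of nodes in decreasing order, closed under going
    up in a column), let C(lambda) say that e(w) lies in K for all words w of
    length n that start with the residues of lambda.  If lambda has n nodes,
    C(lambda) holds by definition of K; the goal is C of the empty shape.  Order
    shapes lexicographically, a bigger node or a longer list counting as bigger;
    C(mu) is deduced from C(nu) for all nu > mu.  A word for mu continues with
    some residue j.  A strand moves freely past strands of residues other than
    its own and the two neighbours (psi^2 e = e), so j travels left until it is
    stuck at a node v of mu ([word_in_append]):
    - if res v = j + 1, the node below v is free and has residue j: filling it
      gives a bigger shape.  The same happens when j reaches the left end and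
      is a charge kappa_m; if it is not a charge, e(w) = 0;
    - if res v = j, the nilHecke relations put e(w) in the ideal of y_v e(w);
    - if res v = j - 1 and v is in the first row, j moves to the second place,
      next to kappa_m, where e(.., kappa_m, kappa_m + 1, ..) = 0;
    - if res v = j - 1 and u is the node above v, then u, v and the new strand
      can be brought together.  They read j, j - 1, j, and the braid relation
      puts e(w) in the ideal generated by the words reading j - 1, j, j and
      j, j, j - 1 there.  The first word truncates mu before u and goes on with
      res u - 1; the second one is the case res v = j, for u.
    So it remains to see, for a node v of mu and p the part of mu before v, that
    y_v kills the words of p v modulo K, and that the words of p followed by
    res v - 1 are in K ([dots_lowered_in]), by induction on the position of v.
    For the first claim, move v next to the node u above it, where
    y_v = y_u - psi^2, and psi^2 factors through a word that lowers the residue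
    of u; in row one, move v to the left end, where y_1 = 0.  The second claim
    is another instance of the insertion argument, and now a node z added to p
    is bigger than v ([lowered_node_gt]), so that p + z is bigger than mu
    although it may be shorter.

    The charges enter only through [spread_charges], which makes a node and the
    node below it commute with all the nodes between them, and similarly for the
    first row. *)

(** * The defining relations *)

Section QuotMorphism.
Variables (F : fieldType) (A : algType F) (S : set A).
Local Notation pi := (@quot_pi A S).
Implicit Types a b c x y : A.

Lemma quot_rel0 x : pi x = pi 0 -> pi x = 0.
Proof. by rewrite rmorph0. Qed.

Lemma quot_relM x y a b : pi (x * y) = pi (a * b) -> pi x * pi y = pi a * pi b.
Proof. by rewrite !rmorphM. Qed.

Lemma quot_relM0 x y : pi (x * y) = pi 0 -> pi x * pi y = 0.
Proof. by rewrite rmorphM rmorph0. Qed.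

Lemma quot_rel_dot x y a b c k :
  pi (x * y * a) = pi ((b * c - k%:R) * a) ->
  pi x * pi y * pi a = (pi b * pi c - k%:R) * pi a.
Proof. by rewrite !rmorphM rmorphB rmorphM rmorph_nat. Qed.

Lemma quot_rel_sqr x y : pi (x ^+ 2 * y) = pi y -> pi x * pi x * pi y = pi y.
Proof. by rewrite !rmorphM. Qed.

Lemma quot_rel_sqr0 x y : pi (x ^+ 2 * y) = pi 0 -> pi x * pi x * pi y = 0.
Proof. by rewrite !rmorphM rmorph0. Qed.

Lemma quot_rel_sqrB x y a b :
  pi (x ^+ 2 * y) = pi ((a - b) * y) ->
  pi x * pi x * pi y = (pi a - pi b) * pi y.
Proof. by rewrite !rmorphM rmorphB. Qed.

Lemma quot_rel_braid x y a (s : bool) :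
  pi (x * y * x * a) = pi ((y * x * y + ((-1) ^+ s)%:A) * a) ->
  pi x * pi y * pi x * pi a = pi y * pi x * pi y * pi a + (-1) ^+ s * pi a.
Proof.
rewrite mulrDl -scalerAl mul1r rmorphD !rmorphM => ->; congr (_ + _).
by case: s; rewrite ?expr1 ?scaleN1r ?rmorphN ?mulN1r // !expr0 scale1r mul1r.
Qed.

End QuotMorphism.

(** The argument applies to any ring with elements that satisfy these relations.
    The braid relation is stated for the words x, x - 1, x, where its error term
    is plus or minus e(i); only the invertibility of that sign matters. *)
Record blob_family (e n : nat) (start : pred 'Z_e) (R : pzRingType)
    (psi : 'I_n.-1 -> R) (Y : 'I_n -> R) (E : n.-tuple 'Z_e -> R) : Prop :=
  BlobFamily {
    bf_start : forall i : n.-tuple 'Z_e, ~~ start i`_0 -> E i = 0;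
    bf_second : forall i : n.-tuple 'Z_e,
      start i`_0 -> i`_1 = i`_0 + 1 -> E i = 0;
    bf_y_start : forall (r : 'I_n) (i : n.-tuple 'Z_e),
      r = 0%N :> nat -> start i`_0 -> Y r * E i = 0;
    bf_y_e : forall r (i : n.-tuple 'Z_e), Y r * E i = E i * Y r;
    bf_psi_e : forall r (i : n.-tuple 'Z_e),
      psi r * E i = E (swap_strands r i) * psi r;
    bf_psi_y_hi : forall (r : 'I_n.-1) (i : n.-tuple 'Z_e),
      psi r * Y (strand_hi r) * E i =
      (Y (strand_lo r) * psi r - (i`_r == i`_r.+1)%:R) * E i;
    bf_y_hi_psi : forall (r : 'I_n.-1) (i : n.-tuple 'Z_e),
      Y (strand_hi r) * psi r * E i =
      (psi r * Y (strand_lo r) - (i`_r == i`_r.+1)%:R) * E i;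
    bf_psi2_eq : forall (r : 'I_n.-1) (i : n.-tuple 'Z_e),
      i`_r = i`_r.+1 -> psi r * psi r * E i = 0;
    bf_psi2_far : forall (r : 'I_n.-1) (i : n.-tuple 'Z_e),
      i`_r \notin [:: i`_r.+1; i`_r.+1 + 1; i`_r.+1 - 1] ->
      psi r * psi r * E i = E i;
    bf_psi2_down : forall (r : 'I_n.-1) (i : n.-tuple 'Z_e),
      i`_r.+1 = i`_r - 1 ->
      psi r * psi r * E i = (Y (strand_lo r) - Y (strand_hi r)) * E i;
    bf_braid : forall (r s : 'I_n.-1) (i : n.-tuple 'Z_e),
      s = r.+1 :> nat -> i`_r.+2 = i`_r -> i`_r.+1 = i`_r - 1 ->
      exists c : bool, psi r * psi s * psi r * E i =
        psi s * psi r * psi s * E i + (-1) ^+ c * E i }.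

Lemma gen_blob_family (F : fieldType) (e l n : nat) (kappa : 'I_l -> 'Z_e) :
  blob_family (mem (codom kappa))
    (@blob_psi F e l n kappa) (@blob_y F e l n kappa) (@blob_e F e l n kappa).
Proof.
pose rel u v (uv : @blob_rel F e l n kappa u v) :
  quot_pi _ u = quot_pi _ v :> presented_alg (blob_rel kappa) :=
  presented_algP uv.
split.
- by move=> i h; apply/quot_rel0/rel/BlobE_start.
- by move=> i h h'; apply/quot_rel0/rel/BlobE_second.
- by move=> r i h h'; apply/quot_relM0/rel/BlobYE_start.
- by move=> r i; apply/quot_relM/rel/BlobYE.
- by move=> r i; apply/quot_relM/rel/BlobPsiE.
- by move=> r i; apply/quot_rel_dot/rel/BlobPsiYhi.
- by move=> r i; apply/quot_rel_dot/rel/BlobYhiPsi.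
- by move=> r i h; apply/quot_rel_sqr0/rel/BlobPsi2_eq.
- by move=> r i h; apply/quot_rel_sqr/rel/BlobPsi2_far.
- by move=> r i h; apply/quot_rel_sqrB/rel/BlobPsi2_down.
move=> r s i sr i2 i1; exists (i`_r == i`_r.+1 - 1).
apply/quot_rel_braid/(etrans (rel _ _ (BlobBraid F kappa i sr))).
rewrite /braid_coef i2 i1 eqxx subrK eqxx /=.
by case: ifP => _; rewrite ?expr1 ?expr0.
Qed.

(** * Local moves on words modulo a two-sided ideal *)

(** Residues of strands that may cross freely. *)
Definition far e (x y : 'Z_e) := x \notin [:: y; y + 1; y - 1].

Lemma far_sym e : symmetric (@far e).
Proof.
move=> x y; rewrite /far !inE !negb_or [x == y]eq_sym; congr (_ && _).
by rewrite andbC; congr (~~ _ && ~~ _);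
  [rewrite eq_sym subr_eq | rewrite -subr_eq eq_sym].
Qed.

Lemma farE e (x y : 'Z_e) :
  far x y = ~~ [|| x == y, x == y + 1 | x == y - 1].
Proof. by rewrite /far !inE. Qed.

Section Words.
Variables (e n : nat) (start : pred 'Z_e) (R : pzRingType).
Variables (psi : 'I_n.-1 -> R) (Y : 'I_n -> R) (E : n.-tuple 'Z_e -> R).
Hypothesis bf : blob_family start psi Y E.
Local Notation lo := strand_lo.
Local Notation hi := strand_hi.
Variable K : set R.
Hypothesis K_ideal : two_sided_ideal K.

(** Words are sequences rather than tuples, so that they can be cut and
    concatenated; a sequence of the wrong length satisfies both predicates
    vacuously. *)
Definition word_in (s : seq 'Z_e) :=
  forall w : n.-tuple 'Z_e, w = s :> seq _ -> K (E w).

Definition dot_in (k : nat) (s : seq 'Z_e) :=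
  forall (w : n.-tuple 'Z_e) (r : 'I_n), w = s :> seq _ -> r = k :> nat ->
    K (Y r * E w).

Let KN x : K x -> K (- x).
Proof. by rewrite -mulN1r; apply: idealMl. Qed.

Let K0 : K 0. Proof. exact: ideal0. Qed.

Let KMl a x : K x -> K (a * x). Proof. exact: idealMl. Qed.

Let KMr x a : K x -> K (x * a). Proof. exact: Defs.idealMr. Qed.

Let KB x y : K x -> K y -> K (x - y).
Proof. by move=> Kx /KN; apply: idealD. Qed.

Let nth_mid0 (a : seq 'Z_e) x s : (a ++ x :: s)`_(size a) = x.
Proof. by rewrite nth_cat ltnn subnn. Qed.

Let nth_mid1 (a : seq 'Z_e) x y s : (a ++ x :: y :: s)`_(size a).+1 = y.
Proof. by rewrite -cat_rcons nth_cat size_rcons ltnn subnn. Qed.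

Lemma tval_swap_strands (r : 'I_n.-1) (w : n.-tuple 'Z_e) a x y b :
  w = a ++ x :: y :: b :> seq _ -> r = size a :> nat ->
  swap_strands r w = a ++ y :: x :: b :> seq _.
Proof.
move=> ws ra; have sn : size (a ++ x :: y :: b) = n by rewrite -ws size_tuple.
apply: (@eq_from_nth _ 0) => [|k].
  by rewrite size_tuple -sn !size_cat.
rewrite size_tuple => kn; rewrite -[k]/(nat_of_ord (Ordinal kn)) -tnth_nth.
rewrite tnth_mktuple (tnth_nth 0) ws.
have [->|klo] := eqVneq (Ordinal kn) (lo r).
  by rewrite tpermL /= ra nth_mid1 nth_mid0.
have [->|khi] := eqVneq (Ordinal kn) (hi r).
  by rewrite tpermR /= ra nth_mid1 nth_mid0.
rewrite tpermD 1?eq_sym //= !nth_cat; case: ltnP => // ak.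
case: (k - size a)%N (subnKC ak) => [|[|i]] //= ki.
  by case/eqP: klo; apply: val_inj; rewrite /= ra -ki addn0.
by case/eqP: khi; apply: val_inj; rewrite /= ra -ki addn1.
Qed.

Lemma strand_at (w : n.-tuple 'Z_e) a x y b : w = a ++ x :: y :: b :> seq _ ->
  {r : 'I_n.-1 | r = size a :> nat &
     (w`_r = x) * (w`_r.+1 = y) *
     (swap_strands r w = a ++ y :: x :: b :> seq _)}%type.
Proof.
move=> ws; have sn : size (a ++ x :: y :: b) = n by rewrite -ws size_tuple.
have ltr : (size a < n.-1)%N.
  by rewrite -sn size_cat /= !addnS /= ltnS leq_addr.
exists (Ordinal ltr) => //; split; last exact: tval_swap_strands.
by rewrite ws /= nth_mid0 nth_mid1.
Qed.

Lemma word_in_swap a x y b : far x y ->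
  word_in (a ++ y :: x :: b) -> word_in (a ++ x :: y :: b).
Proof.
move=> xy Kyx w ws; have [r ra [[wx wy] sw]] := strand_at ws.
rewrite -(bf_psi2_far bf (r := r)) ?wx ?wy // -mulrA (bf_psi_e bf) mulrA.
exact/KMr/KMl/Kyx.
Qed.

Lemma dot_in_swap a x y b : far x y ->
  dot_in (size a) (a ++ y :: x :: b) -> dot_in (size a).+1 (a ++ x :: y :: b).
Proof.
move=> xy Kyx w r' ws r'a; have [r ra [[wx wy] sw]] := strand_at ws.
have -> : r' = hi r by apply: val_inj; rewrite /= ra.
have sws : ((swap_strands r w)`_r == (swap_strands r w)`_r.+1) = false.
  rewrite sw ra nth_mid0 nth_mid1.
  by apply: contraNF xy => /eqP ->; rewrite inE eqxx.
rewrite -(bf_psi2_far bf (r := r)) ?wx ?wy // -mulrA (bf_psi_e bf) !mulrA.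
rewrite (bf_y_hi_psi bf) sws mulr0n subr0 -[X in X * psi r]mulrA.
by exact/KMr/KMl/Kyx.
Qed.

(** In the nilHecke algebra, 1 = psi y_r - y_(r+1) psi = y_r psi - psi y_(r+1).
    Hence modulo y_r one has psi = psi (y_r psi - psi y_(r+1)) = 0, as psi^2 = 0,
    and then 1 = 0. *)
Lemma word_in_repeat a x b :
  dot_in (size a) (a ++ x :: x :: b) -> word_in (a ++ x :: x :: b).
Proof.
move=> Kx w ws; have [r ra [[wx wy] sw]] := strand_at ws.
have {}sw : swap_strands r w = w.
  by apply: val_inj => /=; rewrite -[LHS]/(tval _) sw ws.
have psie := (bf_psi_e bf) r w; rewrite sw in psie.
have Klo : K (Y (lo r) * E w) by apply: Kx.
have Kpsi : K (psi r * E w).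
  have -> : psi r * E w = psi r * (Y (lo r) * E w) * psi r.
    have := congr1 ( *%R (psi r)) ((bf_psi_y_hi bf) r w).
    rewrite wx wy eqxx mulrBl mul1r mulrBr -2!mulrA (bf_y_e bf) !mulrA.
    rewrite (bf_psi2_eq bf) ?wx ?wy // mul0r => /esym/eqP.
    by rewrite subr_eq0 -!mulrA => /eqP <-; rewrite psie.
  exact/KMr/KMl.
have -> : E w = psi r * Y (lo r) * E w - Y (hi r) * psi r * E w.
  by rewrite (bf_y_hi_psi bf) wx wy eqxx mulrBl mul1r subKr.
by rewrite -!mulrA; apply: KB; apply: KMl.
Qed.

(** For residues x, x - 1 one has y_(r+1) = y_r - psi_r^2, and psi_r^2 factors
    through the swapped word. *)
Lemma dot_in_descent a x b :
  dot_in (size a) (a ++ x :: x - 1 :: b) -> word_in (a ++ x - 1 :: x :: b) ->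
  dot_in (size a).+1 (a ++ x :: x - 1 :: b).
Proof.
move=> Ky Ke w r' ws r'a; have [r ra [[wx wy] sw]] := strand_at ws.
have -> : r' = hi r by apply: val_inj; rewrite /= ra.
have -> : Y (hi r) * E w = Y (lo r) * E w - psi r * (psi r * E w).
  by rewrite mulrA (bf_psi2_down bf) ?wx ?wy // mulrBl subKr.
apply: KB; first exact: Ky.
by rewrite (bf_psi_e bf) mulrA; exact/KMr/KMl/Ke.
Qed.

(** On the word x, x - 1, x the error term of the braid relation is invertible,
    while each of the two triple products starts with a swap that leads to one
    of the two words in the hypotheses. *)
Lemma word_in_braid a x b :
  word_in (a ++ x - 1 :: x :: x :: b) -> word_in (a ++ x :: x :: x - 1 :: b) ->
  word_in (a ++ x :: x - 1 :: x :: b).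
Proof.
move=> K1 K2 w ws; have [r ra [[wx wy] sw]] := strand_at ws.
have ws' : w = (a ++ [:: x]) ++ x - 1 :: x :: b :> seq _ by rewrite ws -catA.
have [s sa [[_ wz] sw']] := strand_at ws'.
rewrite size_cat addn1 -ra in sa; rewrite sa in wz.
have Kr : K (psi r * E w).
  by rewrite (bf_psi_e bf); exact/KMr/K1.
have Ks : K (psi s * E w).
  by rewrite (bf_psi_e bf); apply/KMr/K2; rewrite sw' -catA.
have [|//|c] := bf_braid bf (i := w) sa; first by rewrite wz wx.
  by rewrite wx wy.
rewrite addrC => /(canLR (addrK _)) Ec.
have : K ((-1) ^+ c * E w) by rewrite -Ec -!mulrA; apply: KB; exact/KMl/KMl.
by case: c {Ec}; rewrite ?mul1r // mulN1r => /KN; rewrite opprK.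
Qed.

Lemma word_in_start x b : ~~ start x -> word_in (x :: b).
Proof.
by move=> h w ws; rewrite (bf_start bf) ?ws //; exact: K0.
Qed.

Lemma word_in_second x b : word_in (x :: x + 1 :: b).
Proof.
move=> w ws; case xk: (start x); first last.
  by apply: (@word_in_start x) ws; rewrite xk.
by rewrite (bf_second bf) ?ws ?xk //; exact: K0.
Qed.

Lemma dot_in_start x b : dot_in 0 (x :: b).
Proof.
move=> w r ws r0; case xk: (start x).
  by rewrite (bf_y_start bf) ?ws ?xk //; exact: K0.
by rewrite (bf_start bf) ?ws ?xk //= mulr0; exact: K0.
Qed.

Lemma word_in_left a x c b : all (far x) c ->
  word_in (a ++ x :: c ++ b) -> word_in (a ++ c ++ x :: b).
Proof.
elim: c a => //= y c IH a /andP[xy xc] Kx.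
rewrite -cat_rcons; apply: IH => //.
by rewrite cat_rcons; apply: word_in_swap => //; rewrite far_sym.
Qed.

Lemma dot_in_left a x c b : all (far x) c ->
  dot_in (size a) (a ++ x :: c ++ b) ->
  dot_in (size a + size c) (a ++ c ++ x :: b).
Proof.
elim: c a => [|y c IH] a /=; first by rewrite addn0.
move=> /andP[xy xc] Kx; have := IH (rcons a y) xc.
rewrite !cat_rcons size_rcons addSnnS; apply.
by apply: dot_in_swap => //; rewrite far_sym.
Qed.

End Words.

(** * Shapes *)

Section Shapes.
Variable l : nat.
Implicit Types (x y z u v : node l) (s p c : seq (node l)).

(** Reading along rows numbers the nodes, and the order on nodes is the reverse
    of that numbering. *)
Definition node_code x := (x.1 * l + x.2)%N.

Lemma node_ltE x y : node_lt x y = (node_code y < node_code x)%N.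
Proof.
case: x y => [r m] [r' m']; rewrite /node_lt /node_code /=.
have := ltn_ord m; have := ltn_ord m'.
by case: (ltngtP r' r) => [||->]; rewrite ?ltn_add2l //= => *; apply/esym; nia.
Qed.

Definition node_gt x y := node_lt y x.

Lemma node_gt_trans : transitive node_gt.
Proof. by move=> y x z; rewrite /node_gt !node_ltE => /ltn_trans; apply. Qed.

Lemma node_gtxx x : node_gt x x = false.
Proof. by rewrite /node_gt node_ltE ltnn. Qed.

Lemma node_gt_total x y : x != y -> node_gt x y || node_gt y x.
Proof.
case: x y => [r m] [r' m']; rewrite /node_gt /node_lt /= xpair_eqE -val_eqE /=.
by case: (ltngtP r r'); case: (ltngtP m m').
Qed.

Definition node_above x : node l := (x.1.-1, x.2).

(** The nodes of a one-column multipartition, listed as in its tableau. *)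
Definition shape s :=
  [&& pairwise node_gt s, all (fun x => 0 < x.1)%N s &
      all (fun x => (1 < x.1)%N ==> (node_above x \in s)) s].

Lemma shape_row_gt0 s x : shape s -> x \in s -> (0 < x.1)%N.
Proof. by case/and3P=> _ /allP h _; apply: h. Qed.

Lemma shape_above s x : shape s -> x \in s -> (1 < x.1)%N -> node_above x \in s.
Proof. by case/and3P=> _ _ /allP h xs; apply/implyP; apply: h. Qed.

Lemma shape_split p x c : shape (p ++ x :: c) ->
  all (node_gt^~ x) p /\ all (node_gt x) c.
Proof.
case/and3P; rewrite pairwise_cat allrel_consr /=.
by case/and3P=> /andP[px _] _ /andP[xc _].
Qed.

(** The node above x is bigger than x, hence is listed before x. *)
Lemma shape_prefix p c : shape (p ++ c) -> shape p.
Proof.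
move=> sh; have /and3P[] := sh; rewrite pairwise_cat all_cat.
move=> /and3P[/allrelP pc pp _] /andP[p0 _] _; apply/and3P; split=> //.
apply/allP=> x xp; apply/implyP => x1.
have := shape_above sh _ x1; rewrite !mem_cat xp => /(_ isT) /orP[//|/(pc x _ xp)].
by rewrite /node_gt /node_lt /= => /orP[|/andP[/eqP]]; lia.
Qed.

Lemma shape_insert s z : shape s -> z \notin s -> (0 < z.1)%N ->
  ((1 < z.1)%N -> node_above z \in s) ->
  exists p c, [/\ s = p ++ c, all (node_gt^~ z) p, all (node_gt z) c &
                  shape (p ++ z :: c)].
Proof.
move=> sh zs z0 z1.
have [p [c [sE pz zc]]] : exists p c,
    [/\ s = p ++ c, all (node_gt^~ z) p & all (node_gt z) c].
  have /and3P[+ _ _] := sh; elim: s zs {sh z1} => [|x s IH] /=.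
    by exists [::], [::].
  rewrite inE negb_or => /andP[zx zs] /andP[xs /(IH zs)[p [c [sE pz zc]]]].
  have /orP[zx1|xz] := node_gt_total zx.
    exists [::], (x :: s); split=> //=; rewrite zx1.
    by apply: sub_all xs => y; apply: node_gt_trans.
  by exists (x :: p), c; rewrite sE /= xz.
exists p, c; split=> //; have /and3P[pw s0 _] := sh; rewrite sE in pw s0 z1 zs.
apply/and3P; split.
- move: pw; rewrite !pairwise_cat allrel_consr pz /= zc.
  by case/and3P=> -> -> ->.
- by move: s0; rewrite !all_cat /= z0.
have sub : {subset s <= p ++ z :: c}.
  by move=> x; rewrite sE !mem_cat inE; case: (x \in p) => //= ->; rewrite orbT.
apply/allP=> x; rewrite mem_cat inE orbCA -mem_cat -sE => xzs.
apply/implyP=> x1; apply: sub; case/predU1P: xzs x1 => [->|xs]; last exact: shape_above.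
by rewrite sE.
Qed.

Lemma shape_uniq s : shape s -> uniq s.
Proof.
by case/and3P=> pw _ _; apply: pairwise_uniq pw => x; rewrite node_gtxx.
Qed.

Lemma shape_column s m r k : shape s -> (r, m) \in s -> (0 < k <= r)%N ->
  (k, m) \in s.
Proof.
move=> sh; elim: r => [|r IH] rs; first by case: k => // k /andP[_]; rewrite ltn0.
case/andP=> k0; rewrite leq_eqVlt => /predU1P[->//|kr].
apply: IH; last by rewrite k0.
by apply: (shape_above sh rs) => /=; lia.
Qed.

Lemma shape_row_le s x : shape s -> x \in s -> (x.1 <= size s)%N.
Proof.
case: x => r m sh xs /=.
rewrite -(size_iota 1 r) -(size_map (fun k => (k, m) : node l)).
apply: uniq_leq_size => [|_ /mapP[k + ->]].
  by rewrite map_inj_uniq ?iota_uniq // => k k' [].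
by rewrite mem_iota add1n ltnS => kr; apply: shape_column xs kr.
Qed.

Variable n : nat.

(** Shapes with at most n nodes, encoded as binary numbers whose leading digits
    stand for the biggest nodes: the numerical order is the lexicographic order
    on shapes, an extension being bigger than the shape that it extends. *)
Definition shape_weight s :=
  (\sum_(x <- s) 2 ^ (n.+1 * l - node_code x))%N.

Lemma node_code_le x : (x.1 <= n)%N -> (node_code x <= n.+1 * l)%N.
Proof. by rewrite /node_code; have := ltn_ord x.2; nia. Qed.

(** A power of 2 exceeds any sum of distinct smaller powers of 2. *)
Lemma shape_weight_lt z s : pairwise node_gt (z :: s) ->
  all (fun x => x.1 <= n)%N (z :: s) ->
  (shape_weight s < 2 ^ (n.+1 * l - node_code z))%N.
Proof.
elim: s z => [|x s IH] z; first by rewrite /shape_weight big_nil expn_gt0.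
move=> /= /andP[/andP[zx _] xs] /and3P[zn xn sn].
have {IH} := IH x; rewrite /= xn sn => /(_ xs isT).
rewrite -(ltn_add2l (2 ^ (n.+1 * l - node_code x))) /shape_weight big_cons => IH.
apply: leq_trans IH _; rewrite addnn -mul2n -expnS leq_exp2l //.
by have := node_code_le xn; move: zx; rewrite /node_gt node_ltE; lia.
Qed.

Lemma shape_weight_bound s :
  (size s <= n)%N -> (shape_weight s <= n * 2 ^ (n.+1 * l))%N.
Proof.
move=> sn; apply: leq_trans (leq_mul sn (leqnn _)); rewrite /shape_weight.
elim: s {sn} => [|x s IH]; first by rewrite big_nil.
by rewrite big_cons mulSn leq_add // leq_exp2l // leq_subr.
Qed.

(** Inserting z into an initial part p ++ c of a shape makes it bigger than the
    whole shape as soon as z is bigger than all the nodes that were cut off. *)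
Lemma shape_weight_insert p z c s : (size (p ++ c) < n)%N ->
  shape (p ++ z :: c) -> shape (p ++ c ++ s) -> (size (p ++ c ++ s) <= n)%N ->
  all (node_gt z) s ->
  (shape_weight (p ++ c ++ s) < shape_weight (p ++ z :: c))%N.
Proof.
move=> pcn shz shs psn zs.
rewrite /shape_weight !big_cat big_cons /= ltn_add2l addnC ltn_add2r.
apply: shape_weight_lt.
  rewrite /= zs; move: shs => /and3P[]; rewrite !pairwise_cat.
  by case/and3P=> _ _ /and3P[].
apply/andP; split.
  have := @shape_row_le _ z shz; rewrite mem_cat inE eqxx orbT => /(_ isT).
  rewrite !size_cat /= addnS -size_cat => h; exact: leq_trans h pcn.
apply/allP=> x xs; apply: leq_trans psn; apply: shape_row_le => //.
by rewrite !mem_cat xs !orbT.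
Qed.

End Shapes.

(** * Residues of neighbouring nodes *)

Section SpreadCharges.
Variables (e l : nat) (kappa : 'I_l -> 'Z_e).

(** The asymmetry of the second clause reflects the order of the nodes: what
    lies between a node and the node below it is the end of its row, in later
    components, and the start of the next row, in earlier components. *)
Definition spread_charges :=
  (forall i j, i != j -> kappa i - kappa j \notin [:: 0; 1; -1]) /\
  (forall i j : 'I_l, (i < j)%N -> kappa i != kappa j + 2).

Hypothesis kappa_spread : spread_charges.
Local Notation res := (residue kappa).

Lemma eq_shift (a b c d : 'Z_e) : a - b = c - d -> (a == b) = (c == d).
Proof. by rewrite -[a == b]subr_eq0 -[c == d]subr_eq0 => ->. Qed.

Lemma eq_shiftF (a b c d : 'Z_e) :
  (c == d) = false -> c - d = a - b -> (a == b) = false.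
Proof. by move=> cd /esym/eq_shift ->. Qed.

Lemma charge_neq i j (c : 'Z_e) : i != j -> c \in [:: 0; 1; -1] ->
  (kappa i == kappa j + c) = false.
Proof.
move=> ij cin; apply: contraNF (kappa_spread.1 i j ij) => /eqP->.
by rewrite addrAC subrr add0r.
Qed.

Lemma charge_neq0 i j : i != j -> (kappa i == kappa j) = false.
Proof.
by move=> ij; rewrite -[RHS](@charge_neq i j 0 ij) ?addr0 // inE eqxx.
Qed.

Lemma charge_neq1 i j : i != j -> (kappa i == kappa j + 1) = false.
Proof. by move=> ij; rewrite charge_neq // !inE eqxx orbT. Qed.

Lemma charge_neqN1 i j : i != j -> (kappa i == kappa j - 1) = false.
Proof. by move=> ij; rewrite charge_neq // !inE eqxx !orbT. Qed.

Lemma charge_neq2 (i j : 'I_l) : (i < j)%N -> (kappa i == kappa j + 2) = false.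
Proof. by move=> ij; apply/negbTE/kappa_spread.2. Qed.

Lemma charge_far i j : i != j -> far (kappa i) (kappa j).
Proof. by move=> ij; rewrite farE charge_neq0 ?charge_neq1 ?charge_neqN1. Qed.

(** For a strand of residue kappa_j + 1 that has to pass the nodes of the first
    row that come before the one of component j. *)
Lemma charge_succ_far (i j : 'I_l) : (i < j)%N -> far (kappa j + 1) (kappa i).
Proof.
move=> ij; have nij : i != j by rewrite -val_eqE neq_ltn ij.
rewrite far_sym farE charge_neq1 // (eq_shiftF (charge_neq2 ij)); last by ring.
by rewrite (eq_shiftF (charge_neq0 nij)) //; ring.
Qed.

Lemma res_below (v : node l) : res (v.1.+1, v.2) = res v - 1.
Proof. by rewrite /residue /= -natr1 opprD addrA. Qed.

Lemma res_above (v : node l) : (1 < v.1)%N -> res (node_above v) = res v + 1.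
Proof.
by case: v => [[//|r] m] _; have /= -> := res_below (r, m); rewrite subrK.
Qed.

(** A node x between v and the node above it belongs either to the row above v
    and a later component, or to the row of v and an earlier component.  Besides
    non-adjacency of charges, both cases need the second clause of
    [spread_charges], with the components in opposite roles. *)
Lemma between_far (v x : node l) : (1 < v.1)%N ->
  node_gt (node_above v) x -> node_gt x v ->
  far (res v) (res x) /\ far (res v + 1) (res x).
Proof.
case: v x => [[//|r] m] [r' m'] r1; rewrite /node_gt /node_lt /= => h1 h2.
have: (r' == r) && (m < m')%N || (r' == r.+1) && (m' < m)%N.
  by move: h1 h2; case: (ltngtP r' r); case: (ltngtP r' r.+1); lia.
case/orP=> /andP[/eqP-> mm'] {h1 h2}; rewrite /residue /=.
  have nm : m != m' by rewrite -val_eqE neq_ltn mm'.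
  rewrite -natr1 !farE; split.
    rewrite (eq_shiftF (charge_neq1 nm)) //; last by ring.
    rewrite (eq_shiftF (charge_neq2 mm')) //; last by ring.
    by rewrite (eq_shiftF (charge_neq0 nm)) //; ring.
  rewrite (eq_shiftF (charge_neq0 nm)) //; last by ring.
  rewrite (eq_shiftF (charge_neq1 nm)) //; last by ring.
  by rewrite (eq_shiftF (charge_neqN1 nm)) //; ring.
have nm : m' != m by rewrite -val_eqE neq_ltn mm'.
rewrite !(far_sym _ (kappa m' + _ - _)) -natr1 !farE; split.
  rewrite (eq_shiftF (charge_neq0 nm)) //; last by ring.
  rewrite (eq_shiftF (charge_neq1 nm)) //; last by ring.
  by rewrite (eq_shiftF (charge_neqN1 nm)) //; ring.
rewrite (eq_shiftF (charge_neq1 nm)) //; last by ring.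
rewrite (eq_shiftF (charge_neq2 mm')) //; last by ring.
by rewrite (eq_shiftF (charge_neq0 nm)) //; ring.
Qed.

End SpreadCharges.

(** * Inserting a residue into a shape *)

Lemma split_last_failure T (P : pred T) (s : seq T) :
  all P s \/ exists p v c, [/\ s = p ++ v :: c, ~~ P v & all P c].
Proof.
elim: s => [|x s [IH|[p [v [c [-> Pv Pc]]]]]]; first by left.
  by case Px: (P x); [left; rewrite /= Px | right; exists [::], x, s; rewrite Px].
by right; exists (x :: p), v, c.
Qed.

Section Insertion.
Variables (e l n : nat) (kappa : 'I_l -> 'Z_e) (R : pzRingType).
Variables (psi : 'I_n.-1 -> R) (Y : 'I_n -> R) (E : n.-tuple 'Z_e -> R).
Hypothesis kappa_spread : spread_charges kappa.
Hypothesis bf : blob_family (mem (codom kappa)) psi Y E.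
Variable K : set R.
Hypothesis K_ideal : two_sided_ideal K.
Local Notation res := (residue kappa).
Local Notation word_in := (word_in E K).
Local Notation dot_in := (dot_in Y E K).
Implicit Types (p c s lam : seq (node l)) (v z : node l).

Lemma above_split p v c : shape (p ++ v :: c) -> (1 < v.1)%N ->
  exists p1 d, [/\ p = p1 ++ node_above v :: d,
    all (far (res v)) (map res d) & all (far (res v + 1)) (map res d)].
Proof.
move=> sh v1; have [pv vc] := shape_split sh.
have up : node_above v \in p.
  have : node_above v \in p ++ v :: c.
    by apply: shape_above v1 => //; rewrite mem_cat inE eqxx orbT.
  rewrite -cat_rcons mem_cat mem_rcons inE -orbA => /or3P[/eqP av| //|/(allP vc)].
    by have := congr1 fst av; rewrite /=; lia.
  by rewrite /node_gt /node_lt /=; lia.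
have [p1 [d pE]] : exists p1 d, p = p1 ++ node_above v :: d.
  by case/splitPr: up => p1 d; exists p1, d.
have between x : x \in d -> far (res v) (res x) /\ far (res v + 1) (res x).
  move=> xd; apply: between_far => //.
    move: sh; rewrite pE -catA => /shape_split[_ /allP]; apply.
    by rewrite mem_cat xd.
  by apply: (allP pv); rewrite pE mem_cat inE xd !orbT.
exists p1, d; split=> //; apply/allP=> _ /mapP[x xd ->].
  by case: (between x xd).
by case: (between x xd).
Qed.

Lemma row1_before p v c : shape (p ++ v :: c) -> (v.1 <= 1)%N ->
  res v = kappa v.2 /\
  (forall x, x \in p -> (res x = kappa x.2) /\ (x.2 < v.2)%N).
Proof.
move=> sh v1; have [pv _] := shape_split sh.
have vrow : v.1 = 1%N.
  have : (0 < v.1)%N by apply: (shape_row_gt0 sh); rewrite mem_cat inE eqxx orbT.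
  by lia.
split; first by rewrite /residue vrow addrK.
move=> x xp; have x0 : (0 < x.1)%N.
  by apply: shape_row_gt0 sh _; rewrite mem_cat xp.
have xv := allP pv x xp; have [x1 xv2] : x.1 = 1%N /\ (x.2 < v.2)%N.
  move: xv; rewrite /node_gt /node_lt vrow => /orP[h|/andP[/eqP<- //]].
  by move: x0; rewrite ltnNge -ltnS h.
by rewrite /residue x1 addrK.
Qed.

(** If z were smaller than v, it would be in the row of v, where z and v would
    have adjacent charges, or in the next row, its upper neighbour lying before
    v in the row of v: then z and v would have the same charge. *)
Lemma lowered_node_gt p v c q z d : shape (p ++ v :: c) ->
  p = q ++ d -> shape (q ++ z :: d) -> res z = res v - 1 -> node_gt z v.
Proof.
move=> shv pE shz zv; have [pv _] := shape_split shv.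
have v0 : (0 < v.1)%N.
  by apply: shape_row_gt0 shv _; rewrite mem_cat inE eqxx orbT.
have zNv : z != v.
  apply/eqP=> zE; move/eqP: zv; rewrite zE -subr_eq0 opprB addrC subrK.
  by rewrite oner_eq0.
have /orP[//|] := node_gt_total zNv.
rewrite {1}/node_gt /node_lt; case/orP=> [vz|/andP[/eqP z1 vz]]; last first.
  have nm : z.2 != v.2 by rewrite -val_eqE neq_ltn vz orbT.
  have := charge_neqN1 kappa_spread nm.
  rewrite (eq_shift (c := res z) (d := res v - 1)).
    by rewrite zv eqxx.
  by rewrite /residue z1; ring.
have z1 : (1 < z.1)%N by exact: leq_ltn_trans vz.
have : node_above z \in q ++ z :: d.
  by apply: shape_above shz _ z1; rewrite mem_cat inE eqxx orbT.
rewrite mem_cat inE orbCA -mem_cat -pE => /predU1P[zE|/(allP pv)].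
  by have := congr1 fst zE; rewrite /=; lia.
rewrite /node_gt /node_lt /= => /orP[|/andP[/eqP vz' zv2]]; first by lia.
have nm : z.2 != v.2 by rewrite -val_eqE neq_ltn zv2.
have := charge_neq0 kappa_spread nm.
rewrite (eq_shift (c := res z) (d := res v - 1)).
  by rewrite zv eqxx.
have z1E : z.1 = v.1.+1 by lia.
by rewrite /residue z1E -natr1; ring.
Qed.

(** The three targets to which the insertion of a strand into lam is reduced; the
    first two arise for every node v of lam, since the strand may be stopped at
    any node, and since [dots_lowered_in] needs them for all initial parts. *)
Definition dots_in lam := forall p v c, lam = p ++ v :: c ->
  forall b, dot_in (size p) (map res p ++ res v :: b).

Definition lowered_in lam := forall p v c, lam = p ++ v :: c ->
  forall b, word_in (map res p ++ res v - 1 :: b).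

Definition enlarged_in lam j := forall p z c, lam = p ++ c ->
  shape (p ++ z :: c) -> res z = j ->
  forall b, word_in (map res (p ++ z :: c) ++ b).

(** The strand of z commutes to the place of z in the enlarged shape. *)
Lemma word_in_insert lam z b : shape lam -> enlarged_in lam (res z) ->
  z \notin lam -> (0 < z.1)%N -> ((1 < z.1)%N -> node_above z \in lam) ->
  (forall x, x \in lam -> node_gt z x -> far (res z) (res x)) ->
  word_in (map res lam ++ res z :: b).
Proof.
move=> sh hC zl z0 z1 zfar.
have [p [c [lamE _ zc shz]]] := shape_insert sh zl z0 z1.
rewrite lamE map_cat -catA; apply: (word_in_left bf K_ideal).
  rewrite all_map; apply/allP=> x xc; apply: zfar; last exact: (allP zc).
  by rewrite lamE mem_cat xc orbT.
by have := hC p z c lamE shz erefl b; rewrite map_cat -catA.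
Qed.

(** The insertion argument: j moves to the left until it meets a node that it
    cannot cross, and every way of being stuck is covered by a hypothesis. *)
Lemma word_in_append lam j : shape lam ->
  dots_in lam -> lowered_in lam -> enlarged_in lam j ->
  forall b, word_in (map res lam ++ j :: b).
Proof.
move=> sh hA hB hC b.
(* v is the node that stops j on its way to the left *)
have [lamj|[p [v [c [lamE vj cj]]]]] :=
  split_last_failure (fun x => far j (res x)) lam.
  have [/codomP[m jm]|nj] := boolP (j \in codom kappa); last first.
    rewrite -[_ ++ _]/([::] ++ _ ++ _); apply: (word_in_left bf K_ideal).
      by rewrite all_map.
    exact: (word_in_start bf K_ideal).
  pose z : node l := (1%N, m).
  have zj : res z = j by rewrite /residue /= addrK.
  rewrite -zj in lamj hC *; apply: word_in_insert => //.
    by apply/negP=> /(allP lamj); rewrite /far inE eqxx.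
  by move=> x /(allP lamj).
have sh' : shape (p ++ v :: c) by rewrite -lamE.
have [pv vc] := shape_split sh'.
(* res v = j + 1: the node z below v is addable *)
have [vj1|vj1] := eqVneq (res v) (j + 1).
  pose z : node l := (v.1.+1, v.2).
  have zj : res z = j by rewrite res_below vj1 addrK.
  have zx x : x \in lam -> node_gt z x -> far j (res x).
    rewrite lamE mem_cat inE => /or3P[xp|/eqP->|/(allP cj)//].
      by have := allP pv _ xp; rewrite /node_gt /node_lt /=; lia.
    by rewrite /node_gt /node_lt /=; lia.
  rewrite -zj in cj hC zx *; apply: word_in_insert => //.
    rewrite lamE mem_cat inE; apply/negP=> /or3P[zp|/eqP/(congr1 fst)/=|zc].
    - by have := allP pv _ zp; rewrite /node_gt /node_lt /=; lia.
    - by lia.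
    by have := allP cj _ zc; rewrite /far inE eqxx.
  by move=> _; rewrite lamE mem_cat inE /node_above /= -surjective_pairing eqxx orbT.
rewrite lamE map_cat -catA /= -cat_rcons; apply: (word_in_left bf K_ideal).
  by rewrite all_map.
rewrite cat_rcons.
move: vj; rewrite far_sym /far negbK !inE (negPf vj1) /= => /orP[]/eqP vj.
  rewrite vj; apply: (word_in_repeat bf K_ideal).
  by rewrite size_map -vj; apply: (hA p v c).
(* res v = j - 1: bring v and the new strand next to the node above v, so that
   the three read j, j - 1, j *)
have {vj} jE : j = res v + 1 by rewrite vj subrK.
rewrite jE in cj *.
have [v1|v1] := ltnP 1 v.1.
  have [p1 [d [pE dv dv1]]] := above_split sh' v1.
  rewrite pE map_cat /= res_above // -catA /=.
  rewrite -cat_rcons; apply: (word_in_left bf K_ideal dv).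
  rewrite -cat_rcons; apply: (word_in_left bf K_ideal dv1).
  rewrite !cat_rcons.
  have lamE' : lam = p1 ++ node_above v :: (d ++ v :: c) by rewrite lamE pE -catA.
  have ra := res_above kappa v1.
  rewrite -{2}(addrK 1 (res v)).
  apply: (word_in_braid bf K_ideal).
    by have := hB _ _ _ lamE'; rewrite ra; apply.
  apply: (word_in_repeat bf K_ideal).
  by rewrite size_map; have := hA _ _ _ lamE'; rewrite ra; apply.
have [vk resp] := row1_before sh' v1.
(* no node above v: bring kappa_m, kappa_m + 1 to the left end *)
rewrite vk -[X in word_in X]/([::] ++ _).
apply: (word_in_left bf K_ideal).
  rewrite all_map; apply/allP=> x /resp[/= -> xv].
  by apply: (charge_far kappa_spread); rewrite -val_eqE neq_ltn xv orbT.
rewrite /= -[_ :: _]/([:: kappa v.2] ++ _); apply: (word_in_left bf K_ideal).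
  rewrite all_map; apply/allP=> x /resp[/= -> xv].
  exact: (charge_succ_far kappa_spread).
exact: (word_in_second bf K_ideal).
Qed.

(** * The induction on shapes *)

Section Step.
Variable mu : seq (node l).
Hypothesis mu_shape : shape mu.
Hypothesis mu_size : (size mu < n)%N.
Hypothesis heavier_in : forall nu, shape nu -> (size nu <= n)%N ->
  (shape_weight n mu < shape_weight n nu)%N ->
  forall b, word_in (map res nu ++ b).

Lemma insert_in p c s z : mu = p ++ c ++ s -> shape (p ++ z :: c) ->
  all (node_gt z) s -> forall b, word_in (map res (p ++ z :: c) ++ b).
Proof.
move=> muE shz zs; have pcn : (size (p ++ c) < n)%N.
  apply: leq_ltn_trans mu_size.
  by rewrite muE catA [X in (_ <= X)%N]size_cat leq_addr.
apply: heavier_in => //; first by rewrite size_cat /= addnS -size_cat.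
by rewrite muE; apply: shape_weight_insert => //; rewrite -muE // ltnW.
Qed.

(** Both claims are proved together, by induction on the position of the node v:
    each of them relies on both for the nodes before v. *)
Lemma dots_lowered_in : dots_in mu /\ lowered_in mu.
Proof.
suff H k : forall p v c, mu = p ++ v :: c -> (size p < k)%N ->
    (forall b, dot_in (size p) (map res p ++ res v :: b)) /\
    (forall b, word_in (map res p ++ res v - 1 :: b)).
  by split=> p v c muE; have [] := H (size p).+1 p v c muE (leqnn _).
elim: k => // k IH p v c muE; rewrite ltnS => pk.
have IHp p' v' c' : p = p' ++ v' :: c' ->
    (forall b, dot_in (size p') (map res p' ++ res v' :: b)) /\
    (forall b, word_in (map res p' ++ res v' - 1 :: b)).
  move=> pE; apply: (IH p' v' (c' ++ v :: c)); first by rewrite muE pE -catA.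
  by apply: leq_trans pk; rewrite pE size_cat /= addnS leq_addr.
have sh : shape (p ++ v :: c) by rewrite -muE.
split=> b; last first.
  apply: word_in_append.
  - exact: shape_prefix sh.
  - by move=> p' v' c' /IHp[].
  - by move=> p' v' c' /IHp[].
  move=> q z d pE shz zv; apply: (@insert_in _ _ (v :: c)) => //.
    by rewrite muE pE -catA.
  have zv' := lowered_node_gt sh pE shz zv; rewrite /= zv'.
  have [_] := shape_split sh; apply: sub_all => x; exact: node_gt_trans zv'.
(* row one: v moves to the left end, where y_1 e = 0 *)
have [v1|v1] := ltnP 1 v.1; last first.
  have [vk pk'] := row1_before sh v1.
  have := @dot_in_left _ _ _ _ _ _ _ bf _ K_ideal [::] (res v) (map res p) b.
  rewrite size_map /= add0n; apply; last exact: (dot_in_start bf K_ideal).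
  rewrite all_map vk; apply/allP=> x /pk'[/= -> xv].
  by apply: (charge_far kappa_spread); rewrite -val_eqE neq_ltn xv orbT.
have [p1 [d [pE dv _]]] := above_split sh v1.
have ra := res_above kappa v1.
have [] := IHp _ _ _ pE; rewrite ra => Hdot Hlow.
have := @dot_in_left _ _ _ _ _ _ _ bf _ K_ideal
  (rcons (map res p1) (res v + 1)) (res v) (map res d) b dv.
rewrite size_rcons !size_map !cat_rcons pE size_cat /= addnS addSn map_cat /= ra.
rewrite -catA; apply.
have := @dot_in_descent _ _ _ _ _ _ _ bf _ K_ideal (map res p1) (res v + 1)
  (map res d ++ b); rewrite addrK size_map; apply; first exact: Hdot.
by have := Hlow (res v + 1 :: map res d ++ b); rewrite addrK.
Qed.

Lemma shape_word_in b : word_in (map res mu ++ b).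
Proof.
case: b => [|j b].
  move=> w ws; have := mu_size.
  by rewrite -(size_tuple w) ws cats0 size_map ltnn.
have [hA hB] := dots_lowered_in; apply: word_in_append => //.
by move=> p z c muE shz _; apply: (@insert_in p c [::]) => //; rewrite cats0.
Qed.

End Step.

Hypothesis full_shape_in : forall nu, shape nu -> size nu = n ->
  word_in (map res nu).

Lemma all_word_in (s : seq 'Z_e) : word_in s.
Proof.
suff H k : forall mu, shape mu -> (size mu <= n)%N ->
    (n * 2 ^ (n.+1 * l) - shape_weight n mu < k)%N ->
    forall b, word_in (map res mu ++ b).
  by apply: (H _ [::] _ _ (leqnn _)).
elim: k => // k IH mu sh mun muk b.
have [munn|/negPf munn] := eqVneq (size mu) n.
  case: b => [|j b]; first by rewrite cats0; apply: full_shape_in.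
  move=> w ws; have := size_tuple w.
  by rewrite ws size_cat size_map munn /=; lia.
apply: shape_word_in => //; first by rewrite ltn_neqAle munn.
move=> nu shn nun munu; apply: IH => //.
by have := shape_weight_bound nun; lia.
Qed.

End Insertion.

(** * Back to the generalized blob algebra *)

(** For i < j the representatives satisfy kappa_i < kappa_j, so for kappa_i to be
    kappa_j + 2 the latter has to wrap around e.  As kappa_1 <= kappa_i and
    kappa_j <= kappa_l, this leaves only kappa_1 = kappa_l + 1 and
    kappa_1 = kappa_l + 2 modulo e, which are both excluded. *)
Lemma spread_charges_kappa_of (e l n : nat) (khat : 'I_l -> int) :
  (1 < e)%N -> strongly_adjacency_free e n khat ->
  spread_charges (kappa_of e khat).
Proof.
move=> e1 [_ nonadj ends incr]; split=> // i j ij.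
set k := kappa_of e khat in nonadj ends incr *.
have mono (a b : 'I_l) : (a < b)%N -> (k a < k b)%N.
  case: b => b bl /=; elim: b bl => // b IH bl ab.
  have bl' : (b < l)%N by exact: ltn_trans bl.
  apply: (@leq_ltn_trans (k (Ordinal bl'))); last exact: incr.
  move: ab; rewrite ltnS leq_eqVlt => /predU1P[ab|/(IH bl')/ltnW//].
  by rewrite (_ : Ordinal bl' = a) //; apply: val_inj.
have mono' (a b : 'I_l) : (a <= b)%N -> (k a <= k b)%N.
  by rewrite leq_eqVlt => /predU1P[/val_inj->//|/mono/ltnW].
have l0 : (0 < l)%N by exact: leq_ltn_trans (ltn_ord i).
have ll : (l.-1 < l)%N by rewrite prednK.
pose i0 := Ordinal l0; pose i1 := Ordinal ll.
have i0i : (k i0 <= k i)%N by apply: mono'.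
have ji1 : (k j <= k i1)%N by apply: mono' => /=; have := ltn_ord j; lia.
have i01 : i0 != i1 by rewrite -val_eqE /=; have := ltn_ord j; lia.
have ze : (Zp_trunc e).+2 = e by apply: Zp_cast.
have klt a : (k a < e)%N by rewrite -[X in (_ < X)%N]ze ltn_ord.
have ordE (x y : 'Z_e) c : (x + c%:R == y) = ((x + c) %% e == y)%N.
  by rewrite -val_eqE /= Zp_nat /= modnDmr; congr (_ %% _ == _)%N; apply: ze.
have n2 : k i0 != k i1 + 2 by apply: ends.
have n1 : k i0 != k i1 + 1.
  apply: contra (nonadj _ _ i01) => /eqP->.
  by rewrite addrAC subrr add0r !inE eqxx orbT.
move: n1 n2; rewrite ![k i0 == _]eq_sym -[1]/(1%:R) !ordE [k i == _]eq_sym ordE.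
have := mono _ _ ij; have := klt i0; have := klt i1; have := klt i; have := klt j.
move: i0i ji1; move: (nat_of_ord (k i)) (nat_of_ord (k j)).
move: (nat_of_ord (k i0)) (nat_of_ord (k i1)).
move=> c d a b ca bd be ae de ce ab n1 n2; apply/negP=> /eqP abE.
have be2 : (e <= b + 2)%N by rewrite leqNgt; apply/negP=> /modn_small; lia.
have aE : (a = b + 2 - e)%N.
  by rewrite -abE -{1}(subnK be2) modnDr modn_small //; lia.
have [dE|dE] : (d = e - 2 \/ d = e - 1)%N by lia.
  by move: n2; rewrite (_ : d + 2 = e)%N ?modnn; lia.
move: n1 n2; rewrite (_ : d + 1 = e)%N ?modnn; last by lia.
by rewrite (_ : d + 2 = e + 1)%N ?modnDl ?modn_small //; lia.
Qed.

Section FullShapes.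
Variables l n : nat.

Lemma sum_count_column (s : seq (node l)) :
  (\sum_(m < l) count (fun x => x.2 == m) s = size s)%N.
Proof.
elim: s => [|x s IH] /=; first by rewrite big1.
rewrite big_split /= IH (bigD1 x.2) //= eqxx big1 ?addn0 ?add1n // => m.
by rewrite eq_sym => /negbTE->.
Qed.

(** In component m, take the column whose length is the number of nodes of s
    in m.  As s is closed upwards its nodes lie in that diagram; both have n
    elements, so they agree, and both are listed in decreasing order. *)
Lemma full_shape_tableau (s : seq (node l)) : shape s -> size s = n ->
  exists mu : onecol_mpart l n, tableau mu = s :> seq _.
Proof.
move=> sh sn.
pose a : {ffun 'I_l -> 'I_n.+1} :=
  [ffun m => inord (count (fun x => x.2 == m) s)].
have aE m : a m = count (fun x => x.2 == m) s :> nat.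
  by rewrite ffunE inordK // ltnS -sn count_size.
have an : (\sum_(m < l) a m == n)%N.
  by rewrite (eq_bigr _ (fun m _ => aE m)) sum_count_column sn.
exists (exist _ a an); set mu : onecol_mpart l n := exist _ a an.
have sub : {subset s <= tableau mu}.
  case=> r m xs; rewrite (perm_mem (tableau_perm mu)) mem_diagram /=.
  rewrite (shape_row_gt0 sh xs) aE -size_filter.
  rewrite -(size_iota 1 r) -(size_map (fun k => (k, m) : node l)).
  apply: uniq_leq_size => [|_ /mapP[k + ->]].
    by rewrite map_inj_uniq ?iota_uniq // => k k' [].
  rewrite mem_iota add1n ltnS mem_filter eqxx /= => kr.
  exact: shape_column xs kr.
have [|_ st] := uniq_min_size (shape_uniq sh) sub; first by rewrite size_tuple sn.
apply: (@irr_sorted_eq _ (@node_gt l)).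
- exact: node_gt_trans.
- exact: node_gtxx.
- exact: tableau_decreasing.
- by have /and3P[pw _ _] := sh; rewrite sorted_pairwise //; apply: node_gt_trans.
by move=> x; rewrite st.
Qed.

End FullShapes.

Lemma ideal_span_sum (R : pzRingType) (I : finType) (S : I -> set R) :
  two_sided_ideal [set x | exists D : I -> R,
    x = \sum_i D i /\ forall i, ideal_span (S i) (D i)]%classic.
Proof.
split=> [|_ _ [D [-> hD]] [D' [-> hD']]|a _ [D [-> hD]]|_ a [D [-> hD]]].
- exists (fun=> 0); split; first by rewrite big1.
  by move=> i; apply: ideal0 (ideal_span_ideal _).
- exists (fun i => D i + D' i); split; first by rewrite big_split.
  by move=> i; apply: idealD (ideal_span_ideal _) _ _ (hD i) (hD' i).
- exists (fun i => a * D i); split; first by rewrite mulr_sumr.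
  by move=> i; apply: idealMl (ideal_span_ideal _) _ _ (hD i).
exists (fun i => D i * a); split; first by rewrite mulr_suml.
by move=> i; apply: Defs.idealMr (ideal_span_ideal _) _ _ (hD i).
Qed.

Lemma ideal_span_sub_sum (R : pzRingType) (I : finType) (S : I -> set R) i x :
  S i x -> exists D : I -> R,
    x = \sum_i D i /\ forall i, ideal_span (S i) (D i).
Proof.
move=> Sx; exists (fun j => if j == i then x else 0); split.
  by rewrite -big_mkcond big_pred1_eq.
move=> j; case: eqP => [->|_]; last exact: ideal0 (ideal_span_ideal _).
exact: sub_gen_smallest.
Qed.

Theorem corollary18 (e l n : nat) (F : fieldType) (q : F) (khat : 'I_l -> int)
    (he : (1 < e)%N) (hl : (1 < l)%N) (hn : (1 < n)%N)
    (hq : e.-primitive_root q) (hq1 : q != 1)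
    (hkhat : strongly_adjacency_free e n khat) :
  let kappa := kappa_of e khat in
  forall i : n.-tuple 'Z_e,
  exists D : onecol_mpart l n -> gen_blob F n kappa,
    blob_e F kappa i = \sum_(mu : onecol_mpart l n) D mu /\
    forall mu : onecol_mpart l n,
      ideal_span [set blob_e F kappa (residue_seq kappa mu)]%classic (D mu).
Proof.
move=> kappa i.
have spread := spread_charges_kappa_of he hkhat.
pose S (mu : onecol_mpart l n) := [set blob_e F kappa (residue_seq kappa mu)]%classic.
have full (nu : seq (node l)) : shape nu -> size nu = n ->
    word_in (@blob_e F e l n kappa)
    [set x | exists D : onecol_mpart l n -> gen_blob F n kappa,
       x = \sum_mu D mu /\ forall mu, ideal_span (S mu) (D mu)]%classic
    (map (residue kappa) nu).
  move=> shnu nun w wE; have [mu muE] := full_shape_tableau shnu nun.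
  apply: (@ideal_span_sub_sum _ _ S mu); rewrite /S.
  by congr (blob_e _ _ _); apply: val_inj; rewrite /= wE -muE.
exact: (all_word_in spread (gen_blob_family F n kappa) (ideal_span_sum S)
  full erefl).
Qed.
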